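(* Let $X$ be a Banach space and let $A,B,C,D\in\mathcal L(X)$, where $A$ and $D$ have Hirano inverses. If $AB=0$, $BD^H=0$ and $D^{\pi}CB=0$, then $M=\begin{bmatrix}A&B\\ C&D\end{bmatrix}\in M_2(\mathcal L(X))^H$, i.e. $M$ has Hirano inverse in $M_2(\mathcal L(X))$.
   Context: $\mathcal L(X)$ is the Banach algebra of all bounded linear operators on the Banach space $X$; $I$ is the identity operator. $M_2(\mathcal L(X))$ is the algebra of $2\times 2$ matrices over $\mathcal L(X)$ (bounded operators on $X\oplus X$). Let $\mathcal R$ be $\mathcal L(X)$ or $M_2(\mathcal L(X))$ and $T\in\mathcal R$. - $T$ has Hirano inverse if there is $Z\in\mathcal R$ with $TZ=ZT$, $Z=ZTZ$ and $T^2-TZ$ nilpotent; such $Z$ is unique if it exists and is denoted $T^H$. $\mathcal R^H$ denotes the set of elements of $\mathcal R$ having Hirano inverse. - $T^{\pi}=I-TT^D$, where $T^D$ is the Drazin inverse of $T$ (the unique $Z$ with $TZ=ZT$, $Z=ZTZ$, $T-T^2Z$ nilpotent). If $T$ has Hirano inverse then $T^D=T^H$, so $T^{\pi}=I-TT^H$. *)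

(* Defs.v *)
From HB Require Import structures.
From mathcomp Require Import all_boot all_order all_algebra.
From mathcomp Require Import all_classical all_reals all_analysis.

Set Implicit Arguments.
Unset Strict Implicit.
Unset Printing Implicit Defensive.

Import Order.TTheory GRing.Theory Num.Theory.
Import numFieldNormedType.Exports.

Local Open Scope ring_scope.

Section BoundedOperators.
Variables (K : numFieldType) (X : normedModType K).

Record bounded_operator := BoundedOperator {
  bop_fun :> X -> X;
  bop_linear : linear bop_fun;
  bop_bounded : exists M : K, forall x : X, `|bop_fun x| <= M * `|x|
}.

HB.instance Definition _ (T : bounded_operator) :=
  GRing.isLinear.Build K X X *:%R T (bop_linear T).

HB.instance Definition _ := gen_eqMixin bounded_operator.
HB.instance Definition _ := gen_choiceMixin bounded_operator.

Lemma bopP (S T : bounded_operator) : (forall x, S x = T x) -> S = T.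
Proof.
case: S T => [f lf bf] [g lg bg] /= /funext fg.
by case: _ / fg lg bg => lg bg; congr BoundedOperator; exact: Prop_irrelevance.
Qed.

Lemma bop_bounded_ge0 (T : bounded_operator) :
  exists2 M : K, 0 <= M & forall x, `|T x| <= M * `|x|.
Proof.
have [M TM] := bop_bounded T.
have [x0|x0] := pselect (forall x : X, x = 0).
  by exists 0 => // x; rewrite (x0 x) linear0 !normr0 mulr0.
move/existsNP: x0 => [x /eqP x0]; exists M => //.
by rewrite -(pmulr_lge0 _ (_ : 0 < `|x|)) ?normr_gt0// (le_trans _ (TM x)).
Qed.

Lemma bop_zero_bounded : exists M : K, forall x : X, `|(0 : X)| <= M * `|x|.
Proof. by exists 0 => x; rewrite normr0 mul0r. Qed.

Lemma bop_id_bounded : exists M : K, forall x : X, `|x| <= M * `|x|.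
Proof. by exists 1 => x; rewrite mul1r. Qed.

Lemma bop_opp_bounded (T : bounded_operator) :
  exists M : K, forall x : X, `|- T x| <= M * `|x|.
Proof. by have [M TM] := bop_bounded T; exists M => x; rewrite normrN. Qed.

Lemma bop_add_bounded (S T : bounded_operator) :
  exists M : K, forall x : X, `|S x + T x| <= M * `|x|.
Proof.
have [[M SM] [N TN]] := (bop_bounded S, bop_bounded T).
by exists (M + N) => x; rewrite mulrDl (le_trans (ler_normD _ _))// lerD.
Qed.

Lemma bop_comp_bounded (S T : bounded_operator) :
  exists M : K, forall x : X, `|S (T x)| <= M * `|x|.
Proof.
have [[M M0 SM] [N _ TN]] := (bop_bounded_ge0 S, bop_bounded_ge0 T).
by exists (M * N) => x; rewrite (le_trans (SM _))// -mulrA ler_wpM2l.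
Qed.

Definition bop_zero :=
  BoundedOperator (linearP (\0 : {linear X -> X})) bop_zero_bounded.
Definition bop_id :=
  BoundedOperator (linearP (idfun : {linear X -> X})) bop_id_bounded.
Definition bop_opp (T : bounded_operator) :=
  BoundedOperator (linearP (\- T : {linear X -> X})) (bop_opp_bounded T).
Definition bop_add (S T : bounded_operator) :=
  BoundedOperator (linearP (S \+ T : {linear X -> X})) (bop_add_bounded S T).
Definition bop_comp (S T : bounded_operator) :=
  BoundedOperator (linearP (S \o T : {linear X -> X})) (bop_comp_bounded S T).

Lemma bop_addA : associative bop_add.
Proof. by move=> S T U; apply: bopP => x /=; rewrite addrA. Qed.
Lemma bop_addC : commutative bop_add.
Proof. by move=> S T; apply: bopP => x /=; rewrite addrC. Qed.
Lemma bop_add0 : left_id bop_zero bop_add.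
Proof. by move=> S; apply: bopP => x /=; rewrite add0r. Qed.
Lemma bop_addN : left_inverse bop_zero bop_opp bop_add.
Proof. by move=> S; apply: bopP => x /=; rewrite addNr. Qed.

HB.instance Definition _ := GRing.isZmodule.Build bounded_operator
  bop_addA bop_addC bop_add0 bop_addN.

Lemma bop_compA : associative bop_comp.
Proof. by move=> S T U; apply: bopP. Qed.
Lemma bop_comp1l : left_id bop_id bop_comp.
Proof. by move=> S; apply: bopP. Qed.
Lemma bop_comp1r : right_id bop_id bop_comp.
Proof. by move=> S; apply: bopP. Qed.
Lemma bop_compDl : left_distributive bop_comp +%R.
Proof. by move=> S T U; apply: bopP. Qed.
Lemma bop_compDr : right_distributive bop_comp +%R.
Proof. by move=> S T U; apply: bopP => x /=; rewrite linearD. Qed.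

(* Only a pzRingType: when X = {0} the identity operator is zero. *)
HB.instance Definition _ := GRing.Zmodule_isPzRing.Build bounded_operator
  bop_compA bop_comp1l bop_comp1r bop_compDl bop_compDr.

End BoundedOperators.

Notation "''L' ( X )" := (bounded_operator X)
  (at level 8, X at level 2, format "''L' ( X )") : type_scope.

Section HiranoDrazin.
Variable R : pzRingType.
Implicit Types T Z : R.

Definition nilpotent_elt T := exists n : nat, T ^+ n = 0.

Definition is_hirano_inverse T Z :=
  [/\ T * Z = Z * T, Z = Z * T * Z & nilpotent_elt (T ^+ 2 - T * Z)].

Definition has_hirano_inverse T := exists Z, is_hirano_inverse T Z.

Definition is_drazin_inverse T Z :=
  [/\ T * Z = Z * T, Z = Z * T * Z & nilpotent_elt (T - T ^+ 2 * Z)].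

(* The junk value 0 is taken when no inverse exists; otherwise the choice made
   by xget is forced, see hirano_invE and drazin_invE. *)
Definition hirano_inv T : R := xget 0 [set Z | is_hirano_inverse T Z]%classic.
Definition drazin_inv T : R := xget 0 [set Z | is_drazin_inverse T Z]%classic.

Definition spectral_idem T : R := 1 - T * drazin_inv T.

Lemma hirano_drazin T Z : is_hirano_inverse T Z -> is_drazin_inverse T Z.
Proof.
case=> TZ ZTZ [n w0]; split => //; exists (2 * n)%N.
have pp : (T * Z) * (T * Z) = T * Z by rewrite -mulrA [Z * _]mulrA -ZTZ.
have Tp : GRing.comm T (1 - T * Z).
  by apply: commrB; [exact: commr1|apply: commrM => //; exact: commr_refl].
have ee : (1 - T * Z) * (1 - T * Z) = 1 - T * Z.
  by rewrite mulrBr mulr1 mulrBl mul1r pp subrr subr0.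
have wE : T ^+ 2 * (1 - T * Z) = (T ^+ 2 - T * Z) * (1 - T * Z).
  by rewrite [RHS]mulrBl (mulrBr (T * Z)) mulr1 pp subrr subr0.
have we : GRing.comm (T ^+ 2 - T * Z) (1 - T * Z).
  apply/commr_sym/commrB; first by apply: commrX; exact/commr_sym.
  by apply/commr_sym/commrB; [exact: commr1|exact: commr_refl].
have -> : T - T ^+ 2 * Z = T * (1 - T * Z) by rewrite mulrBr mulr1 mulrA.
by rewrite exprM (exprMn_comm _ Tp) [_ ^+ 2 in X in _ * X]expr2 ee wE
  (exprMn_comm _ we) w0 mul0r.
Qed.

Lemma drazin_inverse_uniq T Z W :
  is_drazin_inverse T Z -> is_drazin_inverse T W -> Z = W.
Proof.
have key Y : is_drazin_inverse T Y ->
    exists n, forall m, (n <= m)%N -> T ^+ m * (T * Y) = T ^+ m.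
  case=> TY YTY [n w0]; exists n => m nm.
  have pp : (T * Y) * (T * Y) = T * Y by rewrite -mulrA [Y * _]mulrA -YTY.
  have Tp : GRing.comm T (1 - T * Y).
    by apply: commrB; [exact: commr1|apply: commrM => //; exact: commr_refl].
  have ee : (1 - T * Y) * (1 - T * Y) = 1 - T * Y.
    by rewrite mulrBr mulr1 mulrBl mul1r pp subrr subr0.
  have eX k : (1 - T * Y) * (1 - T * Y) ^+ k = 1 - T * Y.
    by elim: k => [|k IH]; rewrite ?expr0 ?mulr1// exprS IH ee.
  have {}w0 : T ^+ n * (1 - T * Y) ^+ n = 0.
    by rewrite -(exprMn_comm _ Tp) mulrBr mulr1 mulrA -w0 expr2.
  apply/esym/eqP; rewrite -subr_eq0 -{1}[T ^+ m]mulr1 -mulrBr.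
  rewrite -(subnK nm) exprD -mulrA -(eX n).
  have eC : GRing.comm (1 - T * Y) ((1 - T * Y) ^+ n).
    by apply: commrX; exact: commr_refl.
  by rewrite eC [T ^+ n * _]mulrA w0 mul0r mulr0.
move=> HZ HW; have [n nZ] := key _ HZ; have [m mW] := key _ HW.
have [TZ ZTZ _] := HZ; have [TW WTW _] := HW.
pose k := (maxn n m).+1.
have {}nZ : T ^+ k * (T * Z) = T ^+ k by rewrite nZ// leqW// leq_maxl.
have {}mW : T ^+ k * (T * W) = T ^+ k by rewrite mW// leqW// leq_maxr.
have idemX (Y : R) : T * Y = Y * T -> Y = Y * T * Y ->
    Y ^+ k * T ^+ k = T * Y /\ T ^+ k * Y ^+ k = T * Y.
  move=> TY YTY; suff H j : T ^+ j.+1 * Y ^+ j.+1 = T * Y.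
    split; last exact: H.
    by rewrite -(H k.-1); apply: commrX; apply/commr_sym/commrX/commr_sym.
  elim: j => [|j IH]; first by rewrite !expr1.
  by rewrite exprS [Y ^+ _]exprSr mulrA -(mulrA T) IH -mulrA TY -YTY.
have [pZ pZ'] := idemX _ TZ ZTZ; have [pW pW'] := idemX _ TW WTW.
have E1 : (T * Z) * (T * W) = T * Z by rewrite -pZ -mulrA mW.
have E2 : (T * W) * (T * Z) = T * W by rewrite -pW -mulrA nZ.
have Tk (Y : R) : T * Y = Y * T -> GRing.comm (T ^+ k) (T * Y).
  move=> TY; apply/commr_sym/commrX/commr_sym.
  by apply: commrM => //; exact: commr_refl.
have E3 : (T * W) * (T * Z) = T * Z.
  by rewrite -pZ' mulrA -(Tk _ TW) mW.
have E : T * Z = T * W by rewrite -E3.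
by rewrite ZTZ -mulrA E mulrA -TZ E TW -WTW.
Qed.

Lemma hirano_invE T Z : is_hirano_inverse T Z -> hirano_inv T = Z.
Proof.
move=> HZ; apply: (@drazin_inverse_uniq T); apply: hirano_drazin => //.
exact: (@xgetPex _ 0 [set Y | is_hirano_inverse T Y]%classic (ex_intro _ Z HZ)).
Qed.

Lemma drazin_invE T Z : is_drazin_inverse T Z -> drazin_inv T = Z.
Proof.
move=> HZ; apply: (@drazin_inverse_uniq T) => //.
exact: (@xgetPex _ 0 [set Y | is_drazin_inverse T Y]%classic (ex_intro _ Z HZ)).
Qed.

Definition mx22 (a b c d : R) : 'M[R]_2 :=
  @block_mx R 1 1 1 1 a%:M b%:M c%:M d%:M.

End HiranoDrazin.

Notation "T ^H" := (hirano_inv T) (format "T ^H") : ring_scope.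
Notation "T ^D" := (drazin_inv T) (format "T ^D") : ring_scope.
Notation "T ^pi" := (spectral_idem T) (format "T ^pi") : ring_scope.

(* Main.v *)
Require Import Defs.
From mathcomp Require Import all_boot all_order all_algebra.
From mathcomp Require Import all_classical all_reals all_analysis.

(** Having a Hirano inverse is an equational nilpotency condition: in any ring,
    [x] has one if and only if [x - x^3] is nilpotent
    ([has_hirano_inverseP]). The theorem thus becomes a nilpotency
    statement about [f(M)], where [f(x) = x - x^3], given that [f(A)] and [f(D)]
    are nilpotent.

    Put [e = D D^H] and [p = 1 - e], which is [D^pi]. From [B D^H = 0] one gets
    [B e = 0], so the range of [diag(0, e)] is invariant under [M], and [M] acts
    on it as [D]. The quotient by that range is the range of [diag(1, p)], where
    [M] acts as [N = [[A, B], [p C, D]]]. Nilpotency on an invariant subspace and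
    on the quotient by it gives nilpotency ([nilpotent_cubic_defect_ext]), so it
    remains to treat [N].

    Write [N = P + Q] with [P = [[A, 0], [p C, D]]] lower triangular and
    [Q = [[0, B], [0, 0]]]. Here [Q^2 = 0], and the two hypotheses [A B = 0] and
    [p C B = 0] say exactly that [P Q = 0]. Hence
    [f(P + Q) = f(P) + Q (1 - P^2)] is again the sum of a nilpotent and a
    square-zero element whose product vanishes ([nilpotent_cubic_defectD]). That
    [f(P)] is nilpotent follows again from an invariant subspace, the second
    copy of [X], on which [P] acts as [D], and as [A] on the quotient. *)

Set Implicit Arguments.
Unset Strict Implicit.
Unset Printing Implicit Defensive.

Import GRing.Theory.

Local Open Scope ring_scope.

(** * Hirano invertibility and nilpotency of [x - x^3] *)

Section CubicDefect.
Variable R : pzRingType.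
Implicit Types x y z u v e f : R.

Definition cubic_defect x := x - x ^+ 3.

Lemma cubic_defectE x : cubic_defect x = x * (1 - x ^+ 2).
Proof. by rewrite /cubic_defect mulrBr mulr1 -exprS. Qed.

Lemma nilpotentM_comm x y :
  GRing.comm x y -> nilpotent_elt x -> nilpotent_elt (x * y).
Proof. by move=> xy [n xn]; exists n; rewrite exprMn_comm// xn mul0r. Qed.

Lemma nilpotent_exp x n : nilpotent_elt (x ^+ n) -> nilpotent_elt x.
Proof. by case=> m xnm; exists (n * m)%N; rewrite exprM. Qed.

(** With [q = x z] idempotent and [n = x^2 - q] nilpotent, the factor
    [1 - x^2 = 1 - q - n] kills [q] up to a multiple of [n], so that
    [(x - x^3)^2 = (q + n) (1 - q - n)^2] is a multiple of [n]. *)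
Lemma hirano_inverse_nilpotent x z :
  is_hirano_inverse x z -> nilpotent_elt (cubic_defect x).
Proof.
case=> xz zxz nil_n; apply: (@nilpotent_exp _ 2).
set q := x * z in nil_n *; set n := x ^+ 2 - q in nil_n *.
have qq : q * q = q by rewrite /q -mulrA [z * _]mulrA -zxz.
have xq : GRing.comm x q by apply: commrM; [exact: commr_refl|exact: xz].
have nq : GRing.comm n q.
  apply/commr_sym/commrB; last exact: commr_refl.
  by apply: commrX; exact/commr_sym.
have x2 : x ^+ 2 = q + n by rewrite /n addrC subrK.
set r := 1 - x ^+ 2.
have nr : GRing.comm n r.
  rewrite /r x2; apply: commrB; first exact: commr1.
  by apply: commrD => //; exact: commr_refl.
have qr : q * r = - (q * n).
  by rewrite /r x2 mulrBr mulr1 mulrDr qq opprD addrA subrr sub0r.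
have xr : GRing.comm x r.
  by apply: commrB; [exact: commr1|apply: commrX; exact: commr_refl].
have -> : cubic_defect x ^+ 2 = n * (r ^+ 2 + q * n).
  rewrite cubic_defectE -/r exprMn_comm// x2 mulrDl {1}[r ^+ 2]expr2 mulrA qr.
  by rewrite mulNr -nq -mulrA qr mulrN opprK nq addrC -mulrDr.
apply: nilpotentM_comm => //; apply: commrD; first exact: commrX.
by apply: commrM => //; exact: commr_refl.
Qed.

(** With [y = x^2], nilpotency gives [y^k (1 - y)^k = 0] for some [k]. The
    polynomial [e = 1 - (1 - y^k)^k] in [y] is a multiple of [y^k] while [1 - e]
    is a multiple of [(1 - y)^k]; hence [e] is idempotent, and [y - e], being a
    multiple of both [y] and [1 - y], is nilpotent. As [e = x w] with [w]
    a polynomial in [x], the element [w e] is a Hirano inverse of [x]. *)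
Lemma nilpotent_has_hirano_inverse x :
  nilpotent_elt (cubic_defect x) -> has_hirano_inverse x.
Proof.
case=> m dm.
(* The successor ensures that [x] divides [y ^+ k], hence [e] below. *)
pose k := m.+1; pose y := x ^+ 2; pose u := 1 - y ^+ k.
have xy : GRing.comm x y by apply: commrX; exact: commr_refl.
have comm_y z : GRing.comm x z -> GRing.comm z y.
  by move=> xz; apply: commrX; exact: commr_sym.
have x1y : GRing.comm x (1 - y) by apply: commrB => //; exact: commr1.
have xu : GRing.comm x u by apply: commrB; [exact: commr1|exact: commrX].
have yk0 : y ^+ k * (1 - y) ^+ k = 0.
  rewrite -exprMn_comm; last first.
    by apply/commrB; [exact: commr1|exact: commr_refl].
  rewrite {1}/y expr2 -mulrA -cubic_defectE exprMn_comm; last first.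
    by rewrite cubic_defectE; apply: commrM => //; exact: commr_refl.
  by rewrite [cubic_defect x ^+ k]exprS dm !mulr0.
pose s := \sum_(i < k) u ^+ i; pose g := \sum_(i < k) y ^+ i.
have xs : GRing.comm x s by apply: commr_sum => i _; exact: commrX.
have xg : GRing.comm x g by apply: commr_sum => i _; exact: commrX.
pose t := g ^+ k.
have xt : GRing.comm x t by exact: commrX.
pose e := y ^+ k * s.
have eE : e = 1 - u ^+ k.
  rewrite -opprB subrX1 -/s -mulNr opprB; congr (_ * _).
  by rewrite /u opprB addrC subrK.
have e1E : 1 - e = (1 - y) ^+ k * t.
  rewrite eE opprB addrC subrK /t -exprMn_comm; last first.
    by apply/commr_sym/commrB; [exact: commr1|exact: comm_y].
  by congr (_ ^+ _); rewrite /u -opprB subrX1 -/g -mulNr opprB.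
have s1y : GRing.comm s (1 - y).
  by apply: commrB; [exact: commr1|exact: comm_y].
have ee : e * e = e.
  apply/eqP; rewrite eq_sym -subr_eq0 -{1}[e]mulr1 -mulrBr e1E /e.
  rewrite -mulrA [s * _]mulrA (commrX k s1y) -[_ * s * t]mulrA.
  by rewrite (mulrA (y ^+ k)) yk0 mul0r.
have xe : GRing.comm x e by apply: commrM => //; exact: commrX.
pose w := x * y ^+ m * s.
have xw : GRing.comm x w.
  by apply: commrM => //; apply: commrM; [exact: commr_refl|exact: commrX].
have xwE : x * w = e by rewrite /w /e exprS {3}/y expr2 !mulrA.
(* Multiplying [w] by [e] turns the equation [x w = e] into [z x z = z]. *)
have we : GRing.comm w e.
  by rewrite -xwE; apply: commrM; [exact: commr_sym|exact: commr_refl].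
have xweE : x * (w * e) = e by rewrite mulrA xwE ee.
exists (w * e); split.
- by apply: commrM.
- by rewrite -mulrA xweE -mulrA ee.
rewrite xweE -/y.
have yeE : y - e = y * (1 - y ^+ m * s).
  by rewrite mulrBr mulr1 mulrA -exprS.
have yeE' : y - e = (1 - y) * ((1 - y) ^+ m * t - 1).
  by rewrite mulrBr mulr1 mulrA -exprS -e1E opprB [RHS]addrC addrA subrK.
have comm_yX n : GRing.comm y (y ^+ n) by apply: commrX; exact: commr_refl.
have ys : GRing.comm y s by apply: commr_sym; exact: comm_y.
have c1 : GRing.comm y (1 - y ^+ m * s).
  by apply: commrB; [exact: commr1|exact: commrM].
have y1y : GRing.comm y (1 - y).
  by apply: commrB; [exact: commr1|exact: commr_refl].
have c2 : GRing.comm (1 - y) ((1 - y) ^+ m * t - 1).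
  apply: commrB; last exact: commr1.
  apply: commrM; first by apply: commrX; exact: commr_refl.
  by apply/commr_sym/commrB; [exact: commr1|exact: comm_y].
have c3 : GRing.comm (1 - y ^+ m * s) (1 - y).
  apply/commr_sym/commrB; first exact: commr1.
  by apply: commrM; [apply: commrX; exact: commr_sym|exact/commr_sym].
exists (k + k)%N; rewrite exprD {1}yeE yeE' (exprMn_comm _ c1) (exprMn_comm _ c2).
rewrite -(mulrA (y ^+ k)) (mulrA _ ((1 - y) ^+ k)).
rewrite (commrX k (commr_sym (commrX k (commr_sym c3)))).
by rewrite -(mulrA ((1 - y) ^+ k)) (mulrA (y ^+ k)) yk0 mul0r.
Qed.

Lemma has_hirano_inverseP x :
  has_hirano_inverse x <-> nilpotent_elt (cubic_defect x).
Proof.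
split=> [[z]|]; first exact: hirano_inverse_nilpotent.
exact: nilpotent_has_hirano_inverse.
Qed.

Lemma expr_intertwine x y u n : x * u = u * y -> x ^+ n * u = u * y ^+ n.
Proof.
move=> xu; elim: n => [|n IH]; first by rewrite !expr0 mul1r mulr1.
by rewrite exprS -mulrA IH mulrA xu -mulrA -exprS.
Qed.

Lemma cubic_defect_intertwine x y u :
  x * u = u * y -> cubic_defect x * u = u * cubic_defect y.
Proof. by move=> xu; rewrite mulrBl mulrBr xu (expr_intertwine 3 xu). Qed.

(** The equation [x e = e y] makes the range of [e] invariant, [x] acting there
    as [y]. Dually, when [e] is a projection, [f] is the projection onto the
    quotient by that range, and [f x = z f] says that [x] acts on it as [z].
    Since [f] kills a power of the defect of [x], the range of that power lies in
    that of [e], which another power kills. The elements [y] and [z] stand for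
    the two restrictions without any need for rings of operators on subspaces. *)
Lemma nilpotent_cubic_defect_ext x y z e f :
    e + f = 1 -> x * e = e * y -> f * x = z * f ->
    nilpotent_elt (cubic_defect y) -> nilpotent_elt (cubic_defect z) ->
  nilpotent_elt (cubic_defect x).
Proof.
move=> ef1 xe fx [m ym] [n zn]; exists (m + n)%N.
have xme : cubic_defect x ^+ m * e = 0.
  by rewrite (expr_intertwine m (cubic_defect_intertwine xe)) ym mulr0.
have fxn : f * cubic_defect x ^+ n = 0.
  have zf := cubic_defect_intertwine (esym fx).
  by rewrite -(expr_intertwine n zf) zn mul0r.
by rewrite exprD -[X in X * _]mulr1 -ef1 mulrDr xme add0r -mulrA fxn mulr0.
Qed.

(** Every word with a factor [u v] or [v v] vanishes. *)
Lemma exprDn_mul0 u v n :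
  u * v = 0 -> v * v = 0 -> (u + v) ^+ n.+1 = u ^+ n.+1 + v * u ^+ n.
Proof.
move=> uv vv; elim: n => [|n IH]; first by rewrite !expr1 expr0 mulr1.
by rewrite exprS IH mulrDl !mulrDr !mulrA uv vv !mul0r !addr0 -exprS.
Qed.

Lemma nilpotentD_mul0 u v :
  u * v = 0 -> v * v = 0 -> nilpotent_elt u -> nilpotent_elt (u + v).
Proof.
move=> uv vv [n un]; exists n.+1.
by rewrite exprDn_mul0// exprS un !mulr0 addr0.
Qed.

(** Since [u v = v v = 0], one has [(u + v)^3 = u^3 + v u^2], so the defect of
    [u + v] is that of [u] plus [v (1 - u^2)], and these two summands inherit
    the hypotheses on [u] and [v]. *)
Lemma nilpotent_cubic_defectD u v :
    u * v = 0 -> v * v = 0 -> nilpotent_elt (cubic_defect u) ->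
  nilpotent_elt (cubic_defect (u + v)).
Proof.
move=> uv vv nil_u.
have uuv : (1 - u ^+ 2) * v = v.
  by rewrite mulrBl mul1r expr2 -mulrA uv mulr0 subr0.
have -> : cubic_defect (u + v) = cubic_defect u + v * (1 - u ^+ 2).
  rewrite /cubic_defect (exprDn_mul0 2 uv vv) mulrBr mulr1 opprD.
  by rewrite addrACA.
apply: nilpotentD_mul0 => //.
- by rewrite cubic_defectE (mulrA _ v) -(mulrA u) uuv uv mul0r.
- by rewrite (mulrA _ v) -(mulrA v) uuv vv mul0r.
Qed.

End CubicDefect.

(** * Block matrices over a ring *)

Section BlockMatrices.
Variable R : pzRingType.
Implicit Types a b c d e : R.

Lemma mx22M a b c d a' b' c' d' :
  mx22 a b c d * mx22 a' b' c' d' =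
  mx22 (a * a' + b * c') (a * b' + b * d') (c * a' + d * c') (c * b' + d * d').
Proof.
apply: etrans (@mulmx_block R 1 1 1 1 1 1 _ _ _ _ _ _ _ _) _.
by rewrite -!scalar_mxM -!raddfD.
Qed.

Lemma mx22D a b c d a' b' c' d' :
  mx22 a b c d + mx22 a' b' c' d' = mx22 (a + a') (b + b') (c + c') (d + d').
Proof.
apply: etrans (@add_block_mx R 1 1 1 1 _ _ _ _ _ _ _ _) _.
by rewrite -!raddfD.
Qed.

Lemma scalar_mx22 a : a%:M = mx22 a 0 0 a.
Proof. by rewrite /mx22 raddf0 -[RHS]scalar_mx_block. Qed.

Lemma mx22_eq0 : mx22 0 0 0 0 = 0 :> 'M[R]_2.
Proof. by rewrite -scalar_mx22 raddf0. Qed.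

Lemma scalar_mxX n a k : (a%:M : 'M[R]_n) ^+ k = (a ^+ k)%:M.
Proof.
elim: k => [|k IH]; first by rewrite !expr0.
by rewrite !exprS IH scalar_mxM.
Qed.

Lemma nilpotent_cubic_defect_scalar_mx n a :
  nilpotent_elt (cubic_defect a) ->
  nilpotent_elt (cubic_defect (a%:M : 'M[R]_n)).
Proof.
case=> k ak; exists k.
by rewrite /cubic_defect scalar_mxX -raddfB scalar_mxX ak raddf0.
Qed.

(** The second coordinate axis is invariant, with action [d], and the quotient
    is the first one, with action [a]. Since [diag(0, 1)] annihilates the first
    axis, the scalar matrix [d%:M] describes the former action as well as
    [diag(0, d)] would; likewise [a%:M] the latter. *)
Lemma nilpotent_cubic_defect_ltrig a c d :
    nilpotent_elt (cubic_defect a) -> nilpotent_elt (cubic_defect d) ->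
  nilpotent_elt (cubic_defect (mx22 a 0 c d)).
Proof.
move=> nil_a nil_d.
apply: (@nilpotent_cubic_defect_ext _ _ d%:M a%:M (mx22 0 0 0 1) (mx22 1 0 0 0)).
- by rewrite mx22D !(addr0, add0r) -scalar_mx22.
- by rewrite scalar_mx22 !mx22M !(mulr0, mul0r, mulr1, mul1r, addr0, add0r).
- by rewrite scalar_mx22 !mx22M !(mulr0, mul0r, mulr1, mul1r, addr0, add0r).
- exact: nilpotent_cubic_defect_scalar_mx.
- exact: nilpotent_cubic_defect_scalar_mx.
Qed.

(** The range of [diag(0, e)] is invariant because [b e = 0] and [d e = e d].
    The remaining hypotheses on [b] make the upper right corner of the matrix [N]
    on the quotient a square-zero summand annihilated on its left by the lower
    triangular part of [N]. *)
Lemma nilpotent_cubic_defect_mx22 a b c d e :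
    nilpotent_elt (cubic_defect a) -> nilpotent_elt (cubic_defect d) ->
    d * e = e * d -> a * b = 0 -> b * e = 0 -> (1 - e) * c * b = 0 ->
  nilpotent_elt (cubic_defect (mx22 a b c d)).
Proof.
move=> nil_a nil_d de ab be cb.
pose N := mx22 a b ((1 - e) * c) d.
apply: (@nilpotent_cubic_defect_ext _ _ d%:M N (mx22 0 0 0 e)
         (mx22 1 0 0 (1 - e))).
- by rewrite mx22D !(addr0, add0r) addrC subrK -scalar_mx22.
- by rewrite scalar_mx22 !mx22M !(mulr0, mul0r, addr0, add0r) be de.
- rewrite !mx22M !(mulr0, mul0r, mulr1, mul1r, addr0, add0r).
  by rewrite !mulrBr !mulrBl !mulr1 !mul1r be de subr0.
- exact: nilpotent_cubic_defect_scalar_mx.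
have -> : N = mx22 a 0 ((1 - e) * c) d + mx22 0 b 0 0.
  by rewrite mx22D !(addr0, add0r).
apply: nilpotent_cubic_defectD.
- by rewrite mx22M !(mulr0, mul0r, addr0, add0r) ab cb mx22_eq0.
- by rewrite mx22M !(mulr0, mul0r, addr0, add0r) mx22_eq0.
exact: nilpotent_cubic_defect_ltrig.
Qed.

End BlockMatrices.

Unset Implicit Arguments.

Theorem theorem3p7 (K : numFieldType) (X : completeNormedModType K)
    (A B C D : 'L(X))
    (hA : has_hirano_inverse A) (hD : has_hirano_inverse D)
    (hAB : A * B = 0) (hBD : B * D^H = 0) (hDCB : D^pi * C * B = 0) :
  has_hirano_inverse (mx22 A B C D).
Proof.
have [Z HZ] := hD; have [DZ _ _] := HZ.
have HE := hirano_invE HZ; have DE := drazin_invE (hirano_drazin HZ).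
apply/has_hirano_inverseP.
apply: (@nilpotent_cubic_defect_mx22 _ _ _ _ _ (D * Z)).
- exact/has_hirano_inverseP.
- exact/has_hirano_inverseP.
- by rewrite DZ mulrA DZ.
- exact: hAB.
- by rewrite DZ mulrA -HE hBD mul0r.
- by rewrite -DE.
Qed.
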